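(* Let $X$ be a Hilbert space and let $E$ be a nonempty subset of $X$. There exists a constant $C>0$, depending only on $\omega$ (in particular not on $X$ or $E$), such that for each number $A>0$ there exists a (not necessarily linear) operator $$\mathcal{E}_A:\mathcal{J}^{1,\omega}_b(E)\cap\{(f,G):A(f,G)\le A\}\to C^{1,\omega}_b(X)$$ with the following properties: (1) $(\mathcal{E}_A(f,G),\nabla\mathcal{E}_A(f,G))_{|_E}=(f,G)$ for all $(f,G)\in\mathcal{J}^{1,\omega}_b(E)$ with $A(f,G)\le A$; (2) $\|\mathcal{E}_A(f,G)\|_{1,\omega,b}\le C(\|f\|_\infty+\|G\|_\infty+A)$ for all $(f,G)\in\mathcal{J}^{1,\omega}_b(E)$ with $A(f,G)\le A$; (3) if $\{(f_n,G_n)\}_{n\in\mathbb{N}}\subset\mathcal{J}^{1,\omega}_b(E)$ and $(f,G)\in\mathcal{J}^{1,\omega}_b(E)$ are such that $A(f_n,G_n)\le A$ for all $n$, $A(f,G)\le A$, and $(f_n,G_n)$ converges to $(f,G)$ uniformly on $E$, then $(\mathcal{E}_A(f_n,G_n),\nabla\mathcal{E}_A(f_n,G_n))$ converges to $(\mathcal{E}_A(f,G),\nabla\mathcal{E}_A(f,G))$ uniformly on $X$.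
   Context: Spaces are real; $|\cdot|$ is the norm of $X$. $\omega:[0,\infty)\to[0,\infty)$ is a modulus of continuity: a concave, increasing, continuous function with $\omega(0)=0$ and $\lim_{t\to\infty}\omega(t)=\infty$. Put $\varphi(t)=\int_0^t\omega(s)\,ds$. $C^{1,\omega}(X)$ is the set of Fréchet differentiable $h:X\to\mathbb{R}$ with $M_\omega(\nabla h):=\sup_{x\ne y}\frac{|\nabla h(x)-\nabla h(y)|}{\omega(|x-y|)}<\infty$. $C^{1,\omega}_b(X)$ is the set of $h\in C^{1,\omega}(X)$ such that $h$ and $\nabla h$ are bounded on $X$, with norm $\|h\|_{1,\omega,b}=\|h\|_\infty+\|\nabla h\|_\infty+M_\omega(\nabla h)$. For $f:E\to\mathbb{R}$, $G:E\to X$, $$A(f,G)=\sup_{x\in X;\ y,z\in E,\ |x-y|+|x-z|>0}\frac{|f(y)+\langle G(y),x-y\rangle-f(z)-\langle G(z),x-z\rangle|}{\varphi(|x-y|)+\varphi(|x-z|)}$$ (the functional $A(\cdot,\cdot)$ is not to be confused with the number $A$). $\mathcal{J}^{1,\omega}_b(E)$ is the vector space of pairs $(f,G):E\to\mathbb{R}\times X$ with $A(f,G)<\infty$ and $f$, $G$ bounded on $E$; $\|f\|_\infty,\|G\|_\infty$ are sup norms over $E$. *)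

(* Defs.v *)
From HB Require Import structures.
From mathcomp Require Import all_boot all_order all_algebra.
From mathcomp Require Import all_classical all_reals all_analysis.

Set Implicit Arguments.
Unset Strict Implicit.
Unset Printing Implicit Defensive.

Import Order.TTheory GRing.Theory Num.Theory.
Import numFieldNormedType.Exports.

Local Open Scope classical_set_scope.
Local Open Scope ring_scope.

(* Only the values of [omega] on [0, +oo[ are constrained (and ever used). *)
Record modulus_of_continuity (R : realType) (omega : R -> R) : Prop := {
  modulus_ge0 : forall t, 0 <= t -> 0 <= omega t ;
  modulus0 : omega 0 = 0 ;
  modulus_increasing : {in `[0, +oo[ &, {homo omega : s t / s <= t}} ;
  modulus_concave : forall s t l : R, 0 <= s -> 0 <= t -> 0 <= l <= 1 ->
    l * omega s + (1 - l) * omega t <= omega (l * s + (1 - l) * t) ;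
  modulus_continuous : {within `[0, +oo[, continuous omega} ;
  modulus_unbounded : omega t @[t --> +oo] --> +oo
}.

Definition phi (R : realType) (omega : R -> R) (t : R) : R :=
  \int[lebesgue_measure]_(s in `[0, t]) omega s.

(* Supremum of a set of nonnegative quantities: adjoining 0 only matters when
   [S] is empty (e.g. difference quotients on the zero space), where
   [ereal_sup] alone would give -oo. *)
Definition nnsup (R : realType) (S : set (\bar R)) : \bar R :=
  ereal_sup ([set 0%E] `|` S).

Definition supnorm (R : realType) (T : Type) (V : normedModType R)
    (f : T -> V) : \bar R :=
  nnsup [set `|f x|%:E | x in [set: T]].

Definition hilbert_product (R : realType) (X : completeNormedModType R)
    (dot : {dot X for idfun}) : Prop :=
  forall x : X, `|x| ^+ 2 = dot x x.

Section Spaces.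
Context (R : realType) (X : completeNormedModType R) (dot : {dot X for idfun}).
Variables (omega : R -> R) (E : set X).

(* The Riesz representative of the Fréchet differential; meaningful when [h]
   is differentiable at [x]. *)
Definition grad (h : X -> R^o) (x : X) : X :=
  get [set g : X | forall v : X, 'd h x v = dot g v].

Definition M_omega (H : X -> X) : \bar R :=
  nnsup [set (`|H p.1 - H p.2| / omega `|p.1 - p.2|)%:E
        | p in [set p : X * X | p.1 != p.2]].

Definition C1omega : set (X -> R^o) :=
  [set h | (forall x, differentiable h x) /\ (M_omega (grad h) < +oo)%E].

Definition C1omega_b : set (X -> R^o) :=
  [set h | [/\ C1omega h, bounded_fun h & bounded_fun (grad h)]].

Definition C1omega_b_norm (h : X -> R^o) : \bar R :=
  (supnorm h + supnorm (grad h) + M_omega (grad h))%E.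

(* Pairs (f, G) of functions defined on the subset [E] only. *)
Definition jet : Type := ((E -> R^o) * (E -> X))%type.

Definition jetA (fG : jet) : \bar R :=
  let T (y : E) (x : X) : R := fG.1 y + dot (fG.2 y) (x - set_val y) in
  nnsup [set a | exists (x : X) (y z : E),
    0 < `|x - set_val y| + `|x - set_val z| /\
    a = (`|T y x - T z x| /
         (phi omega `|x - set_val y| + phi omega `|x - set_val z|))%:E].

Definition J1omega_b : set jet :=
  [set fG | [/\ (jetA fG < +oo)%E, bounded_fun fG.1 & bounded_fun fG.2]].

End Spaces.

Arguments J1omega_b {R X} dot omega E _ : rename.

(* Main.v *)
Require Import Defs.
From HB Require Import structures.
From mathcomp Require Import all_boot all_order all_algebra.
From mathcomp Require Import all_classical all_reals all_analysis.
From mathcomp Require Import ring lra.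
Set Implicit Arguments.
Unset Strict Implicit.
Unset Printing Implicit Defensive.
Import Order.TTheory GRing.Theory Num.Theory.
Import numFieldNormedType.Exports.
Local Open Scope classical_set_scope.
Local Open Scope ring_scope.

(** Let [T_y] be the first-order Taylor polynomial that the jet prescribes at
    [y], and suppose first that [f] and [G] are bounded by [1] and that
    [A(f, G) <= 1]. An extension whose gradient has modulus of continuity
    [omega] lies between the lower cones [T_y - phi|. - y|] and the upper cones
    [T_y + phi|. - y|], and [A(f, G) <= 1] says exactly that each lower cone
    lies below each upper cone. So the problem is to insert, between a family
    of lower cones and a family of upper cones, a function whose gradient has
    a multiple of [omega] as modulus of continuity.

    Call [u] semiconvex (semiconcave) when a two-point convexity (concavity)
    inequality holds up to an error measured by [phi]. In a Hilbert space
    [phi|.|] is semiconcave ([primitive_norm_supergradient]). Let [F] be the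
    largest semiconvex function below all upper cones. It is above the lower
    cones, which are semiconvex. It is also semiconcave
    ([envelope_semiconcave]): an average of two translates of [F], lowered by
    the two-point error, is again semiconvex, and it is below every upper cone
    because those are semiconcave; hence it is below [F] by maximality, and this
    inequality is the semiconcavity of [F].

    A function that is both semiconvex and semiconcave satisfies
    [|F(x + v) - F x - L v| <= K phi|v|] with [L] linear
    ([semiconvex_semiconcave_differential]); the Riesz representation theorem
    turns [L] into a gradient, and comparing expansions at two points bounds its
    modulus of continuity ([gradient_estimate_modulus]). At a point of [E] the
    two cones with that vertex touch, so [F] and its gradient take the
    prescribed values.

    Boundedness comes from adding a constant [1 + r] to the upper barriers. As
    [phi] is superlinear, [r] can be chosen, depending only on [omega], such
    that all lower cones are below [1 + r] and all upper cones above
    [-(1 + r)]. Superlinearity also makes cones with a remote vertex irrelevant,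
    so a uniform perturbation of the jet moves the relevant upper cones, and
    then [F], by a comparable amount, although the Taylor polynomials themselves
    are unbounded ([normalized_extension_lipschitz]).

    A general jet is divided by [M = A + |f| + |G|] (sup norms), extended, and
    multiplied back by [M]. This gives bounds linear in [M], and [M] depends
    continuously on the jet. Uniform convergence of the gradients follows from
    that of the functions because the second-order estimates are uniform
    ([gradient_estimate_close]). *)

(** * The modulus and its primitive *)

Section Modulus.
Context {R : realType} {omega : R -> R}.
Hypothesis omegaP : modulus_of_continuity omega.

Local Notation phi := (phi omega).

Lemma modulus_homo (s t : R) : 0 <= s -> s <= t -> omega s <= omega t.
Proof.
move=> s0 st; apply: (modulus_increasing omegaP) => //;
  rewrite in_itv /= andbT //; exact: le_trans st.
Qed.

Lemma modulus_star (l t : R) : 0 <= l <= 1 -> 0 <= t ->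
  l * omega t <= omega (l * t).
Proof.
move=> l01 t0; have := modulus_concave omegaP t0 (lexx 0) l01.
by rewrite (modulus0 omegaP) !mulr0 !addr0.
Qed.

(** [omega t / t] is nonincreasing. *)
Lemma modulus_ratio (s t : R) : 0 <= s -> s <= t -> s * omega t <= t * omega s.
Proof.
move=> s0; rewrite le_eqVlt => /predU1P[->//|st].
have t0 : 0 < t by exact: le_lt_trans st.
have := @modulus_star (s / t) t; rewrite divfK ?gt_eqF// => H.
rewrite -(ler_pM2l (x := t^-1)) ?invr_gt0// !mulrA mulVf ?gt_eqF// mul1r.
rewrite (mulrC t^-1); apply: H; last exact: ltW.
by rewrite divr_ge0 ?(ltW t0)//= ler_pdivrMr// mul1r ltW.
Qed.

Lemma modulus_subadditive (s t : R) : 0 <= s -> 0 <= t ->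
  omega (s + t) <= omega s + omega t.
Proof.
move=> s0 t0.
have [st0|st0] := eqVneq (s + t) 0.
  rewrite st0 (modulus0 omegaP) addr_ge0 ?(modulus_ge0 omegaP)//.
have st : 0 < s + t by rewrite lt_neqAle eq_sym st0 addr_ge0.
have h1 : s * omega (s + t) <= (s + t) * omega s.
  by apply: modulus_ratio => //; rewrite lerDl.
have h2 : t * omega (s + t) <= (s + t) * omega t.
  by apply: modulus_ratio => //; rewrite lerDr.
rewrite -(ler_pM2l st); lra.
Qed.

Lemma modulus_lipschitz (s t : R) : 0 <= s -> 0 <= t ->
  `|omega s - omega t| <= omega `|s - t|.
Proof.
wlog st : s t / s <= t => [H s0 t0|s0 t0].
  have [/H->//|/ltW ts] := leP s t.
  by rewrite distrC (distrC s); apply: H.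
rewrite distrC (distrC s) !ger0_norm ?subr_ge0//; last exact: modulus_homo.
have ts0 : 0 <= t - s by rewrite subr_ge0.
by rewrite lerBlDr -{1}(subrK s t) modulus_subadditive.
Qed.

Lemma modulus_small (e : R) : 0 < e -> exists2 d, 0 < d & omega d < e.
Proof.
move=> e0.
have /continuous_within_itvcyP[_] := modulus_continuous omegaP.
move=> /cvgrPdist_lt /(_ _ e0); rewrite (modulus0 omegaP) => small.
near (0 : R)^'+ => d; exists d => //.
suff: `|0 - omega d| < e by rewrite sub0r normrN; apply/le_lt_trans/ler_norm.
by near: d.
Unshelve. all: by end_near. Qed.

Lemma modulus_large (M : R) : exists2 t, 0 < t & M <= omega t.
Proof.
have := modulus_unbounded omegaP => /cvgryPge /(_ M) [a [_ Ha]].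
exists (Num.max a 0 + 1); first by rewrite ltr_wpDl// le_max lexx orbT.
by apply: Ha; rewrite (le_lt_trans (y := Num.max a 0)) ?le_max ?lexx// ltrDl.
Qed.

Lemma modulus_gt0 (t : R) : 0 < t -> 0 < omega t.
Proof.
move=> t0; have [s s0 /= ws] := modulus_large 1.
have [st|/ltW ts] := leP s t.
  by rewrite (lt_le_trans ltr01)// (le_trans ws)// modulus_homo// ltW.
have := modulus_ratio (ltW t0) ts.
rewrite -(pmulr_rgt0 _ s0); apply: lt_le_trans.
by rewrite mulr_gt0// (lt_le_trans ltr01).
Qed.

Lemma modulus_primitive0 : phi 0 = 0.
Proof. by rewrite /Defs.phi set_itv1 Rintegral_set1. Qed.

Let integrable_modulus (r : R) :
  lebesgue_measure.-integrable `[0, r] (EFin \o omega).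
Proof.
apply: continuous_compact_integrable; first exact: segment_compact.
apply: continuous_subspaceW (modulus_continuous omegaP).
by move=> x /=; rewrite !in_itv /= andbT => /andP[].
Qed.

Let modulus_primitiveB (s r : R) : 0 <= s -> s <= r ->
  phi r - phi s = \int[lebesgue_measure]_(x in `]s, r]) omega x.
Proof. by move=> s0 sr; rewrite Rintegral_itvB. Qed.

Let integrable_modulus_oc (s r : R) : 0 <= s ->
  lebesgue_measure.-integrable `]s, r] (EFin \o omega).
Proof.
move=> s0; apply: integrableS (integrable_modulus r) => //.
by apply: subset_itvr; rewrite bnd_simp.
Qed.

Let integral_cst_oc (s r c : R) : s <= r ->
  \int[lebesgue_measure]_(x in `]s, r]) c = c * (r - s).
Proof.
move=> sr; rewrite Rintegral_cst//= lebesgue_measure_itv/= lte_fin.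
have [//|rs] := ltP s r.
by rewrite (@le_anti _ _ s r) ?subrr// sr rs.
Qed.

(** Monotonicity of [omega] makes [phi] convex with subgradient [omega].
    Together with [phi 0 = 0], this inequality is all that the sequel uses
    about the integral. *)
Lemma modulus_subgradient (s r : R) : 0 <= s -> 0 <= r ->
  phi r - phi s <= omega r * (r - s).
Proof.
move=> s0 r0.
have int_cst c a b :
    lebesgue_measure.-integrable `]a, b] (EFin \o (fun=> c)).
  suff: lebesgue_measure.-integrable `[a, b] (EFin \o (fun=> c)).
    by apply: integrableS => //; apply: subset_itvr; rewrite bnd_simp.
  apply: continuous_compact_integrable; first exact: segment_compact.
  by apply: continuous_subspaceT => x; exact: cvg_cst.
have [sr|/ltW rs] := leP s r.
  rewrite modulus_primitiveB// -integral_cst_oc//; apply: le_Rintegral => //.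
    exact: integrable_modulus_oc.
  move=> x /=; rewrite in_itv /= => /andP[sx xr].
  by apply: modulus_homo xr; rewrite (le_trans s0)// ltW.
rewrite -lerN2 opprB -mulrN opprB modulus_primitiveB// -integral_cst_oc//.
apply: le_Rintegral => //.
- exact: integrable_modulus_oc.
- by move=> x /=; rewrite in_itv /= => /andP[/ltW rx xs]; apply: modulus_homo.
Qed.

Lemma primitive_ge0 (t : R) : 0 <= t -> 0 <= phi t.
Proof.
move=> t0; have := modulus_subgradient t0 (lexx 0).
by rewrite modulus_primitive0 (modulus0 omegaP) mul0r sub0r oppr_le0.
Qed.

Lemma primitive_le (t : R) : 0 <= t -> phi t <= t * omega t.
Proof.
move=> t0; have := modulus_subgradient (lexx 0) t0.
by rewrite modulus_primitive0 !subr0 mulrC.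
Qed.

Lemma primitive_homo (s t : R) : 0 <= s -> s <= t -> phi s <= phi t.
Proof.
move=> s0 st; rewrite -subr_le0.
apply: le_trans (modulus_subgradient (le_trans s0 st) s0) _.
by rewrite mulr_ge0_le0 ?(modulus_ge0 omegaP)// subr_le0.
Qed.

(** With [primitive_le], this makes [phi t] and [t * omega t] comparable, so
    that errors of either form may be exchanged. *)
Lemma primitive_ge (t : R) : 0 <= t -> t * omega t <= 4 * phi t.
Proof.
move=> t0; have t20 : 0 <= t / 2 by rewrite divr_ge0.
have h1 := modulus_subgradient t0 t20.
have h2 := primitive_ge0 t20.
have h3 : 2^-1 * omega t <= omega (2^-1 * t).
  by apply: modulus_star => //; rewrite invr_ge0 ler0n/= invf_le1// ler1n.
rewrite mulrC in h3; rewrite (mulrC _ t) in h3.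
have h4 : t * (omega t / 2) <= t * omega (t / 2) by rewrite ler_wpM2l.
lra.
Qed.

Lemma primitive_gt0 (t : R) : 0 < t -> 0 < phi t.
Proof.
move=> t0; have := primitive_ge (ltW t0).
rewrite -(pmulr_rgt0 (x := 4))//; apply: lt_le_trans.
by rewrite mulr_gt0// modulus_gt0.
Qed.

(** A linear function dominated by [K * phi] near [0] is nonpositive, because
    [phi t = o(t)]; this is how differentials are shown to be unique. *)
Lemma le0_of_primitive (K a c : R) : 0 <= K -> 0 <= a ->
  (forall s, 0 < s -> s * c <= K * phi (s * a)) -> c <= 0.
Proof.
move=> K0 a0 H; rewrite leNgt; apply/negP => c0.
have Ka : 0 < K * a + 1 by rewrite ltr_wpDl// mulr_ge0.
have [d d0 wd] := modulus_small (divr_gt0 c0 Ka).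
have a1 : 0 < a + 1 by rewrite ltr_wpDl.
pose s := d / (a + 1).
have s0 : 0 < s by rewrite divr_gt0.
have sa : s * a <= d.
  rewrite /s -mulrA ger_pMr// mulrC ler_pdivrMr// mul1r lerDl; exact: ler01.
have sa0 : 0 <= s * a by rewrite mulr_ge0// ltW.
have h1 : phi (s * a) <= (s * a) * omega d.
  by apply: le_trans (primitive_le sa0) _; rewrite ler_wpM2l// modulus_homo.
have h2 : s * c <= s * (K * a * omega d).
  rewrite [leRHS](_ : _ = K * (s * a * omega d)); last by ring.
  by apply: le_trans (H _ s0) _; rewrite ler_wpM2l.
rewrite (ler_pM2l s0) in h2.
rewrite ltr_pdivlMr// mulrDr mulr1 in wd.
have := modulus_gt0 d0; lra.
Qed.

End Modulus.

(** * Inner products *)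

Section InnerProduct.
Context {R : realType} {X : completeNormedModType R} {dot : {dot X for idfun}}.
Hypothesis dotP : hilbert_product dot.

Lemma dotC (x y : X) : dot x y = dot y x.
Proof. by rewrite hermC expr0 mul1r. Qed.

Lemma dotDl (x y z : X) : dot (x + y) z = dot x z + dot y z.
Proof. exact: linearDl. Qed.

Lemma dotDr (x y z : X) : dot x (y + z) = dot x y + dot x z.
Proof. exact: linearDr. Qed.

Lemma dotBl (x y z : X) : dot (x - y) z = dot x z - dot y z.
Proof. exact: linearBl. Qed.

Lemma dotBr (x y z : X) : dot x (y - z) = dot x y - dot x z.
Proof. exact: linearBr. Qed.

Lemma dotNl (x y : X) : dot (- x) y = - dot x y.
Proof. exact: linearNl. Qed.

Lemma dotNr (x y : X) : dot x (- y) = - dot x y.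
Proof. exact: linearNr. Qed.

Lemma dotZl (a : R) (x y : X) : dot (a *: x) y = a * dot x y.
Proof. exact: linearZl_LR. Qed.

Lemma dotZr (a : R) (x y : X) : dot x (a *: y) = a * dot x y.
Proof. exact: linearZr_LR. Qed.

Lemma dot0r (x : X) : dot x 0 = 0.
Proof. exact: linear0r. Qed.

Lemma sqr_normD (x y : X) : `|x + y| ^+ 2 = `|x| ^+ 2 + 2 * dot x y + `|y| ^+ 2.
Proof. by rewrite !dotP dotDl !dotDr (dotC y x); ring. Qed.

(** Since [|.|] is already known to be a norm, this is the triangle inequality
    squared. *)
Lemma cauchy_schwarz (x y : X) : `|dot x y| <= `|x| * `|y|.
Proof.
have le (z : X) : dot x z <= `|x| * `|z|.
  have := sqr_normD x z; have := ler_normD x z.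
  have := normr_ge0 (x + z); have := normr_ge0 x; have := normr_ge0 z.
  move=> z0 x0 s0 tri /esym e.
  have : `|x + z| ^+ 2 <= (`|x| + `|z|) ^+ 2.
    by rewrite ler_sqr// nnegrE addr_ge0.
  rewrite -e; nra.
by rewrite ler_norml le andbT lerNl -dotNr -(normrN y).
Qed.

Lemma dot_inj (p q : X) : (forall v, dot p v = dot q v) -> p = q.
Proof.
move=> pq; apply/eqP; rewrite -subr_eq0 -normr_eq0 -sqrf_eq0 dotP dotBl pq.
by rewrite subrr.
Qed.

(** The representative is the minimizer of [J v = |v|^2 - 2 L v]. The
    parallelogram identity makes minimizing sequences Cauchy, and minimality
    along each line [v + R w] identifies [L w] with the inner product. *)
Lemma riesz (L : X -> R) (C : R) :
  (forall x y, L (x + y) = L x + L y) -> (forall a x, L (a *: x) = a * L x) ->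
  (forall x, `|L x| <= C * `|x|) -> exists p, forall v, L v = dot p v.
Proof.
move=> LD LZ Lb.
pose J v := `|v| ^+ 2 - 2 * L v.
have J_lb v : - C ^+ 2 <= J v.
  have := Lb v; rewrite ler_norml /J => /andP[_ h].
  by have := sqr_ge0 (`|v| - C); nra.
pose d := inf (range J).
have J_inf : has_inf (range J).
  split; first by exists (J 0), 0.
  by exists (- C ^+ 2) => _ [v _ <-].
have dJ v : d <= J v by apply: ge_inf; [case: J_inf|exists v].
have /choice[u uP] (n : nat) : exists v, J v < d + n.+1%:R^-1.
  have [] := @inf_adherent _ (range J) n.+1%:R^-1 _ J_inf.
    by rewrite invr_gt0.
  by move=> _ [v _ <-] ?; exists v.
have JD v w (t : R) :
    J (v + t *: w) = J v + 2 * t * (dot v w - L w) + t ^+ 2 * `|w| ^+ 2.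
  rewrite /J sqr_normD dotZr LD LZ normrZ exprMn real_normK ?num_real//; ring.
(* The parallelogram identity, read off from [JD] at the midpoint. *)
have udist n m : `|u n - u m| ^+ 2 <= 2 * (n.+1%:R^-1 + m.+1%:R^-1).
  have h := dJ (u m + 2^-1 *: (u n - u m)).
  have := JD (u m) (u n - u m) 1; rewrite scale1r [_ + (_ - _)]addrC subrK.
  rewrite JD in h.
  move: (uP n) (uP m) h; rewrite mulr1 expr1n mul1r divff// mul1r.
  move: (J (u n)) (J (u m)) (dot _ _ - L _) (`|u n - u m|) => jn jm c W.
  move: n.+1%:R^-1 m.+1%:R^-1 => a b; lra.
have ucvg : cvg (u @ \oo).
  apply/cauchy_cvgP/cauchy_exP => e e0.
  have e4 : 0 < e ^+ 2 / 4 by rewrite divr_gt0// exprn_gt0.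
  have [N _ HN] := near_infty_natSinv_lt (PosNum e4).
  exists (u N); exists N => // n /= Nn.
  rewrite -ball_normE /ball_/= -ltr_sqr ?nnegrE//; last exact: ltW.
  apply: le_lt_trans (udist _ _) _.
  move: (HN _ Nn) (HN _ (leqnn N)) => /=.
  by move: N.+1%:R^-1 n.+1%:R^-1 => a b; lra.
exists (lim (u @ \oo)) => w; apply/esym/eqP; rewrite -subr_eq0.
set p := lim _; set c := dot p w - L w; have [//|c0] := boolP (c == 0).
have w0 : 0 < `|w|.
  rewrite normr_gt0; apply: contra c0 => /eqP w0.
  by have := LZ 0 0; rewrite /c w0 dot0r scale0r mul0r => ->; rewrite subrr.
exfalso.
(* Testing minimality at [u n + t *: w] with the optimal [t = - b / |w|^2]. *)
have cun n : (dot (u n) w - L w) ^+ 2 <= n.+1%:R^-1 * `|w| ^+ 2.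
  set b := dot _ _ - _; have := dJ (u n + (- b / `|w| ^+ 2) *: w).
  have W0 : `|w| ^+ 2 != 0 by rewrite sqrf_eq0 gt_eqF.
  rewrite JD -/b => h.
  have := uP n; set k := n.+1%:R^-1 => h2.
  have : b ^+ 2 / `|w| ^+ 2 <= k.
    have : 2 * (- b / `|w| ^+ 2) * b + (- b / `|w| ^+ 2) ^+ 2 * `|w| ^+ 2 =
        - (b ^+ 2 / `|w| ^+ 2).
      by field; rewrite gt_eqF.
    by move: k h2 h => k; lra.
  by rewrite ler_pdivrMr// exprn_gt0.
have c20 : 0 < (c / 2) ^+ 2 / `|w| ^+ 2.
  apply: divr_gt0; last exact: exprn_gt0.
  by rewrite exprn_even_gt0//= mulf_neq0// invr_neq0.
have [N1 _ H1] := near_infty_natSinv_lt (PosNum c20).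
have cw : 0 < `|c| / (2 * `|w|) by rewrite divr_gt0 ?mulr_gt0// normr_gt0.
have /cvgrPdist_lt /(_ _ cw) [N2 _ H2] : u n @[n --> \oo] --> p by [].
pose n := maxn N1 N2.
have /= h1 := H1 n (leq_maxl _ _); have /= h2 := H2 n (leq_maxr _ _).
have h3 : `|dot (p - u n) w| < `|c| / 2.
  apply: le_lt_trans (cauchy_schwarz _ _) _.
  by rewrite -ltr_pdivlMr// -mulrA -invfM.
have h4 : `|dot (u n) w - L w| < `|c| / 2.
  rewrite -ltr_sqr ?nnegrE ?divr_ge0// real_normK ?num_real//.
  apply: le_lt_trans (cun n) _.
  rewrite -ltr_pdivlMr ?exprn_gt0//; apply: lt_le_trans h1 _.
  by rewrite ler_pM2r ?invr_gt0 ?exprn_gt0// !exprMn real_normK ?num_real.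
have : `|c| < `|c| / 2 + `|c| / 2.
  apply: le_lt_trans (ltrD h3 h4); apply: le_trans (ler_normD _ _).
  by rewrite dotBl addrA subrK.
by rewrite -splitr ltxx.
Qed.

End InnerProduct.

(** * Semiconvex and semiconcave functions *)

Section Semiconvexity.
Context {R : realType} {X : normedModType R} (omega : R -> R).

Local Notation phi := (phi omega).

(** This is the error that appears when a function supported at [x] by
    [u x + p v - K phi|v|] is averaged over [x + a] and [x + b] with barycenter
    [x]. Allowing all weights, rather than midpoints only, is what yields
    differentiability without a Dini condition on [omega]. *)
Definition two_point_error (K l : R) (a b : X) : R :=
  K * (l * phi `|a| + (1 - l) * phi `|b|).

Definition semiconvex (K : R) (u : X -> R) : Prop :=
  forall x a b l, 0 <= l <= 1 -> l *: a + (1 - l) *: b = 0 ->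
  u x <= l * u (x + a) + (1 - l) * u (x + b) + two_point_error K l a b.

Definition semiconcave (K : R) (u : X -> R) : Prop :=
  forall x a b l, 0 <= l <= 1 -> l *: a + (1 - l) *: b = 0 ->
  l * u (x + a) + (1 - l) * u (x + b) <= u x + two_point_error K l a b.

Lemma semiconvexN (K : R) (u : X -> R) :
  semiconvex K (fun x => - u x) <-> semiconcave K u.
Proof.
by split=> H x a b l l01 ab0; have := H x a b l l01 ab0; lra.
Qed.

Lemma semiconcaveN (K : R) (u : X -> R) :
  semiconcave K (fun x => - u x) <-> semiconvex K u.
Proof.
by split=> H x a b l l01 ab0; have := H x a b l l01 ab0; lra.
Qed.

Lemma semiconvex_cst (omegaP : modulus_of_continuity omega) (K c : R) :
  0 <= K -> semiconvex K (fun=> c).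
Proof.
move=> K0 x a b l /andP[l0 l1] _.
rewrite -mulrDl (addrC l) subrK mul1r lerDl.
by rewrite mulr_ge0// addr_ge0// mulr_ge0 ?subr_ge0// primitive_ge0.
Qed.

Lemma semiconvex_shift (K c : R) (u : X -> R) :
  semiconvex K u -> semiconvex K (fun x => u x - c).
Proof. by move=> H x a b l l01 ab0; have := H x a b l l01 ab0; lra. Qed.

(** The two-point inequality along a line, with denominators cleared. *)
Lemma semiconcave_collinear (K : R) (u : X -> R) (x v : X) (s t : R) :
  semiconcave K u -> 0 < s -> 0 < t ->
  t * u (x + s *: v) + s * u (x - t *: v) <=
  (s + t) * u x + K * (t * phi (s * `|v|) + s * phi (t * `|v|)).
Proof.
move=> H s0 t0; have st0 : 0 < s + t by exact: addr_gt0.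
have l01 : 0 <= t / (s + t) <= 1.
  by rewrite ler_pdivrMr// mul1r lerDr (ltW s0) andbT divr_ge0// ltW.
have e1 : 1 - t / (s + t) = s / (s + t) by field; rewrite gt_eqF.
have := H x (s *: v) (- (t *: v)) _ l01.
rewrite /two_point_error e1 normrN !normrZ !gtr0_norm// => h.
rewrite -(ler_pM2r (x := (s + t)^-1)) ?invr_gt0//.
have -> : ((s + t) * u x + K * (t * phi (s * `|v|) + s * phi (t * `|v|))) /
    (s + t) = u x +
    K * (t / (s + t) * phi (s * `|v|) + s / (s + t) * phi (t * `|v|)).
  by field; rewrite gt_eqF.
rewrite [leLHS](_ : _ = t / (s + t) * u (x + s *: v) +
  s / (s + t) * u (x - t *: v)); last by ring.
apply: h; rewrite -scaleNr !scalerA -scalerDl (_ : _ + _ = 0) ?scale0r//.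
by field; rewrite gt_eqF.
Qed.

Lemma semiconvex_collinear (K : R) (u : X -> R) (x v : X) (s t : R) :
  semiconvex K u -> 0 < s -> 0 < t ->
  (s + t) * u x <= t * u (x + s *: v) + s * u (x - t *: v) +
    K * (t * phi (s * `|v|) + s * phi (t * `|v|)).
Proof.
move=> /semiconcaveN H s0 t0.
by have := semiconcave_collinear x v H s0 t0; lra.
Qed.

End Semiconvexity.

(** * The largest semiconvex minorant *)

Section Envelope.
Context {R : realType} {X : normedModType R} (omega : R -> R).
Variables (K : R) (U : set (X -> R)).

Definition semiconvex_minorants : set (X -> R) :=
  [set h | semiconvex omega K h /\ forall u, U u -> forall x, h x <= u x].

Definition semiconvex_envelope (x : X) : R :=
  sup [set h x | h in semiconvex_minorants].

Hypotheses (U0 : U !=set0) (minorant0 : semiconvex_minorants !=set0).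

Local Notation F := semiconvex_envelope.

Let has_sup_minorants (x : X) : has_sup [set h x | h in semiconvex_minorants].
Proof.
split; first by have [h hU] := minorant0; exists (h x), h.
by have [u Uu] := U0; exists (u x) => _ [h [_ hU] <-]; exact: hU.
Qed.

Lemma envelope_ge h x : semiconvex_minorants h -> h x <= F x.
Proof.
by move=> hU; apply: sup_ubound; [case: (has_sup_minorants x)|exists h].
Qed.

Lemma envelope_le u x : U u -> F x <= u x.
Proof.
move=> Uu; apply: ge_sup; first by case: (has_sup_minorants x).
by move=> _ [h [_ hU] <-]; exact: hU.
Qed.

Lemma envelope_semiconvex : semiconvex omega K F.
Proof.
move=> x a b l l01 ab0; apply: ge_sup; first by case: (has_sup_minorants x).
move=> _ [h hU <-]; have [hK _] := hU; apply: le_trans (hK _ _ _ _ l01 ab0) _.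
have /andP[l0 l1] := l01.
by rewrite lerD2r lerD// ler_wpM2l ?subr_ge0// envelope_ge.
Qed.

(** Semiconvexity is stable under translations, averages and subtraction of
    constants. So the average of two translates of the envelope, lowered by the
    two-point error, is a competitor as soon as it lies below the barriers,
    which is their semiconcavity; maximality of the envelope concludes. *)
Lemma envelope_semiconcave :
  (forall u, U u -> semiconcave omega K u) -> semiconcave omega K F.
Proof.
move=> UK x a b l l01 ab0; have /andP[l0 l1] := l01; rewrite -lerBlDr.
set e := two_point_error _ _ _ _ _.
pose h y := l * F (y + a) + (1 - l) * F (y + b) - e.
suff hU : semiconvex_minorants h by exact: (envelope_ge x hU).
split.
  apply: semiconvex_shift => y c d m m01 cd0.
  have ha := envelope_semiconvex (y + a) m01 cd0.
  have hb := envelope_semiconvex (y + b) m01 cd0.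
  rewrite !(addrAC y _ a) !(addrAC y _ b).
  have l1' : 0 <= 1 - l by rewrite subr_ge0.
  have := ler_wpM2l l0 ha; have := ler_wpM2l l1' hb; lra.
move=> u Uu y; rewrite /h lerBlDr; apply: le_trans (UK u Uu y a b l l01 ab0).
by rewrite lerD// ler_wpM2l ?subr_ge0// envelope_le.
Qed.

End Envelope.

(** * Differentials of semiconvex and semiconcave functions *)

Section Differentiation.
Context {R : realType} {X : normedModType R} {omega : R -> R}.
Hypothesis omegaP : modulus_of_continuity omega.
Variables (K : R) (K0 : 0 <= K) (u : X -> R).
Hypotheses (ucvx : semiconvex omega K u) (uccv : semiconcave omega K u).

Local Notation phi := (phi omega).

(** Semiconvexity says that each corrected backward quotient [r t] is below
    each corrected forward quotient [q s]; any number in between is a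
    subgradient on the line. *)
Let line_subgradient (x v : X) :
  exists D, forall s, u x + s * D - K * phi (`|s| * `|v|) <= u (x + s *: v).
Proof.
pose q s := (u (x + s *: v) - u x + K * phi (s * `|v|)) / s.
pose r t := (u x - u (x - t *: v) - K * phi (t * `|v|)) / t.
have rq s t : 0 < s -> 0 < t -> r t <= q s.
  move=> s0 t0; rewrite /r /q ler_pdivrMr// mulrAC ler_pdivlMr//.
  by have := semiconvex_collinear x v ucvx s0 t0; lra.
pose Q := [set q s | s in [set s | 0 < s]].
have Q0 : Q !=set0 by exists (q 1), 1 => //=.
have Qr t : 0 < t -> r t <= inf Q.
  by move=> t0; apply: lb_le_inf => // _ [s /= s0 <-]; exact: rq.
have Qq s : 0 < s -> inf Q <= q s.
  move=> s0; apply: ge_inf; last by exists s.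
  by exists (r 1) => _ [s' /= s'0 <-]; exact: rq.
exists (inf Q) => s; have [s0|s0|->] := ltgtP s 0.
- have t0 : 0 < - s by rewrite oppr_gt0.
  have := Qr _ t0; rewrite /r ler_pdivrMr// scaleNr opprK (ltr0_norm s0); lra.
- by have := Qq _ s0; rewrite /q ler_pdivlMr// (gtr0_norm s0); lra.
- by rewrite normr0 scale0r !mul0r modulus_primitive0 mulr0 subr0 !addr0.
Qed.

(** Semiconcavity bounds the forward increment by the backward increment of
    length [t], which the subgradient controls; the errors vanish as
    [t] tends to [0]. *)
Let line_derivative (x v : X) : exists D, forall s,
  `|u (x + s *: v) - u x - s * D| <= K * phi (`|s| * `|v|).
Proof.
have [D lowD] := line_subgradient x v; exists D.
have up s w E :
    (forall t, u x + t * E - K * phi (`|t| * `|w|) <= u (x + t *: w)) ->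
    0 < s -> u (x + s *: w) - u x - s * E <= K * phi (s * `|w|).
  move=> lowE s0; rewrite -subr_le0.
  apply: (@le0_of_primitive _ _ omegaP (2 * K * s) `|w|) => //.
    by rewrite !mulr_ge0// ltW.
  move=> t t0; have := lowE (- t); have := semiconcave_collinear x w uccv s0 t0.
  rewrite normrN (gtr0_norm t0) scaleNr => h1 h2.
  have := ler_wpM2l (ltW s0) h2; lra.
move=> s; have low := lowD s; rewrite ler_norml; apply/andP; split; first lra.
have [s0|s0|->] := ltgtP s 0.
- have t0 : 0 < - s by rewrite oppr_gt0.
  have := up (- s) (- v) (- D) _ t0.
  rewrite scalerN scaleNr opprK normrN mulrNN (ltr0_norm s0); apply => t.
  by have := lowD (- t); rewrite normrN scalerN scaleNr mulrN mulNr.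
- by rewrite (gtr0_norm s0); exact: up.
- by rewrite normr0 scale0r !mul0r modulus_primitive0 mulr0 subr0 addr0 subrr.
Qed.

(** Additivity of the directional derivatives: [x + s (v + w)] is the midpoint
    of [x + 2 s v] and [x + 2 s w], and the midpoint inequalities hold with an
    error [o(s)]. *)
Lemma semiconvex_semiconcave_differential (x : X) : exists L : X -> R,
  [/\ forall v w, L (v + w) = L v + L w,
      forall a v, L (a *: v) = a * L v
    & forall v, `|u (x + v) - u x - L v| <= K * phi `|v| ].
Proof.
have [L LP] := choice (line_derivative x).
have uniq v c K1 a : 0 <= K1 -> 0 <= a -> (forall s : R,
    `|u (x + s *: v) - u x - s * c| <= K1 * phi (`|s| * a)) -> L v = c.
  move=> K10 a0 H.
  pose A := a + `|v|.
  have A0 : 0 <= A by rewrite addr_ge0.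
  have aA s : phi (`|s| * a) <= phi (`|s| * A).
    by apply: primitive_homo; rewrite // ?mulr_ge0// ler_wpM2l// lerDl.
  have vA s : phi (`|s| * `|v|) <= phi (`|s| * A).
    by apply: primitive_homo; rewrite // ?mulr_ge0// ler_wpM2l// lerDr.
  have close (s : R) : `|s * (L v - c)| <= (K + K1) * phi (`|s| * A).
    rewrite (_ : s * _ = (u (x + s *: v) - u x - s * c) -
      (u (x + s *: v) - u x - s * L v)); last by ring.
    apply: le_trans (ler_normB _ _) _; rewrite mulrDl addrC lerD//.
      by apply: le_trans (LP v s) _; rewrite ler_wpM2l.
    by apply: le_trans (H s) _; rewrite ler_wpM2l.
  have KK : 0 <= K + K1 by exact: addr_ge0.
  apply/eqP; rewrite eq_le; apply/andP; split; rewrite -subr_le0.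
    apply: (le0_of_primitive omegaP KK A0) => s s0.
    by have := close s; rewrite (gtr0_norm s0); apply/le_trans/ler_norm.
  apply: (le0_of_primitive omegaP KK A0) => s s0.
  have := close s; rewrite (gtr0_norm s0) -normrN -mulrN opprB.
  exact/le_trans/ler_norm.
exists L; split.
- move=> v w; pose A := 2 * (`|v| + `|w|).
  have A0 : 0 <= A by rewrite mulr_ge0// addr_ge0.
  apply: (@uniq _ _ (2 * K) A) => // [|s]; first by rewrite mulr_ge0.
  have := LP v (2 * s); have := LP w (2 * s).
  have half : 0 <= (2^-1 : R) <= 1 by rewrite invr_ge0 ler0n invf_le1// ler1n.
  pose d := s *: (v - w).
  have d0 : (2^-1 : R) *: d + (1 - 2^-1) *: (- d) = 0.
    by rewrite scalerN -scalerBl (_ : _ - _ = 0) ?scale0r//; field.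
  have := uccv (x + s *: (v + w)) half d0.
  have := ucvx (x + s *: (v + w)) half d0.
  rewrite /two_point_error normrN.
  have -> : x + s *: (v + w) + d = x + (2 * s) *: v.
    rewrite -addrA /d -scalerDr addrACA subrr addr0 -mulr2n.
    by rewrite mulrC -scalerA scaler_nat.
  have -> : x + s *: (v + w) - d = x + (2 * s) *: w.
    rewrite -addrA /d -scalerBr opprB (addrC (v + w)) addrA subrK.
    by rewrite -mulr2n mulrC -scalerA scaler_nat.
  have dA : phi `|d| <= phi (`|s| * A).
    apply: primitive_homo => //; rewrite normrZ ler_wpM2l//.
    apply: le_trans (ler_normB _ _) _; rewrite /A ler_peMl ?ler1n// addr_ge0//.
  have vA : phi (`|2 * s| * `|v|) <= phi (`|s| * A).
    apply: primitive_homo; rewrite // ?mulr_ge0// normrM ger0_norm// /A.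
    by rewrite (mulrC 2) -mulrA !ler_wpM2l// lerDl.
  have wA : phi (`|2 * s| * `|w|) <= phi (`|s| * A).
    apply: primitive_homo; rewrite // ?mulr_ge0// normrM ger0_norm// /A.
    by rewrite (mulrC 2) -mulrA !ler_wpM2l// lerDr.
  have := ler_wpM2l K0 dA; have := ler_wpM2l K0 vA; have := ler_wpM2l K0 wA.
  move: (phi `|d|) (phi (_ * `|v|)) (phi (_ * `|w|)) (phi (_ * A)).
  move=> pd pv pw pA.
  rewrite !ler_norml => h1 h2 h3 h4 h5 /andP[h6 h7] /andP[h8 h9].
  by apply/andP; split; lra.
- move=> a v; apply: (@uniq _ _ K `|a *: v|) => // s.
  by rewrite scalerA mulrA normrZ (mulrA `|s|) -normrM; exact: LP.
- by move=> v; have := LP v 1; rewrite scale1r normr1 !mul1r.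
Qed.

End Differentiation.

(** * From second-order estimates to gradients *)

Section Gradient.
Context {R : realType} {X : completeNormedModType R} {dot : {dot X for idfun}}.
Hypothesis dotP : hilbert_product dot.
Context {omega : R -> R}.
Hypothesis omegaP : modulus_of_continuity omega.

Local Notation phi := (phi omega).

Definition gradient_estimate (K : R) (u : X -> R) (p : X -> X) : Prop :=
  forall x v, `|u (x + v) - u x - dot (p x) v| <= K * phi `|v|.

Lemma norm_le_of_dot (q : X) (t a : R) : 0 <= t -> 0 <= a ->
  (forall v, `|v| = t -> dot q v <= a) -> t * `|q| <= a.
Proof.
move=> t0 a0 H; have [->|q0] := eqVneq q 0; first by rewrite normr0 mulr0.
have q1 : `|q| != 0 by rewrite normr_eq0.
have := H ((t / `|q|) *: q).
rewrite normrZ normrM normfV normr_id (ger0_norm t0) divfK// => /(_ erefl).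
by rewrite dotZr -dotP expr2 mulrA divfK.
Qed.

(** The bound [B] makes the differential bounded, hence representable. *)
Lemma ex_gradient_estimate (K B : R) (u : X -> R) : 0 <= K ->
  semiconvex omega K u -> semiconcave omega K u -> (forall x, `|u x| <= B) ->
  exists p, gradient_estimate K u p.
Proof.
move=> K0 ucvx uccv uB.
suff H x : exists q, forall v, `|u (x + v) - u x - dot q v| <= K * phi `|v|.
  by have [p pP] := choice H; exists p.
have [L [LD LZ LP]] :=
  semiconvex_semiconcave_differential omegaP K0 ucvx uccv x.
suff [q qP] : exists q, forall v, L v = dot q v.
  by exists q => v; rewrite -qP.
apply: (riesz dotP (C := 2 * B + K * phi 1) LD LZ) => v.
have [->|v0] := eqVneq v 0.
  by have := LZ 0 0; rewrite scale0r mul0r normr0 mulr0 => ->; rewrite normr0.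
have v1 : `|v| != 0 by rewrite normr_eq0.
have -> : v = `|v| *: (`|v|^-1 *: v) by rewrite scalerA mulfV// scale1r.
set w := _ *: v.
have w1 : `|w| = 1 by rewrite normrZ normfV normr_id mulVf.
rewrite LZ normrM normr_id normrZ normr_id w1 mulr1 mulrC ler_wpM2r//.
have := LP w; rewrite w1; have := uB x; have := uB (x + w).
rewrite !ler_norml => /andP[? ?] /andP[? ?] /andP[? ?]; apply/andP; split; lra.
Qed.

Section Consequences.
Variables (K : R) (u : X -> R^o) (p : X -> X).
Hypotheses (K0 : 0 <= K) (up : gradient_estimate K u p).

(** A named copy of [dot q] to carry the linear structure that differentials
    have. *)
Definition dot_fun (q v : X) : R^o := dot q v.

Let dot_fun_linear (q : X) : linear (dot_fun q).
Proof. by move=> a v w; rewrite /dot_fun dotDr dotZr. Qed.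

HB.instance Definition _ (q : X) :=
  GRing.isLinear.Build R X R^o *:%R (dot_fun q) (dot_fun_linear q).

Let dot_fun_continuous (q : X) : continuous (dot_fun q).
Proof.
move=> x; apply/cvgrPdist_lt => e e0; near=> y.
rewrite /dot_fun -dotBr; apply: le_lt_trans (cauchy_schwarz dotP _ _) _.
have q1 : 0 < `|q| + 1 by rewrite ltr_wpDl.
apply: (@le_lt_trans _ _ ((`|q| + 1) * `|x - y|)).
  by rewrite ler_wpM2r// lerDl.
rewrite mulrC -ltr_pdivlMr//; near: y.
by apply: cvgr_dist_lt => //; rewrite divr_gt0.
Unshelve. all: by end_near. Qed.

Let diff_gradient (x : X) :
  u \o shift x = cst (u x) + dot_fun (p x) +o_ (0 : X) id.
Proof.
apply/eqaddoP => e e0.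
have K1 : 0 < K + 1 by rewrite ltr_wpDl.
have [d d0 dP] := modulus_small omegaP (divr_gt0 e0 K1).
near=> v.
have vd : `|v| <= d.
  apply: ltW; near: v; apply: nbhs0_lt => //.
rewrite /= /dot_fun !fctE /= opprD addrA (addrC v).
apply: le_trans (up x v) _.
apply: le_trans (_ : K * (`|v| * omega d) <= _).
  rewrite ler_wpM2l//; apply: le_trans (primitive_le omegaP (normr_ge0 v)) _.
  by rewrite ler_wpM2l// modulus_homo.
rewrite mulrCA mulrC ler_wpM2r//.
move: dP; rewrite ltr_pdivlMr// => /ltW; apply: le_trans.
by rewrite mulrC ler_wpM2l ?lerDl// (modulus_ge0 omegaP)// ltW.
Unshelve. all: by end_near. Qed.

Let diffE (x : X) : 'd u x = dot_fun (p x) :> (X -> R^o).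
Proof.
by apply: diff_unique; [exact: dot_fun_continuous|exact: diff_gradient].
Qed.

Lemma gradient_estimate_differentiable (x : X) : differentiable u x.
Proof.
apply/diff_locallyP; rewrite diffE.
by split; [exact: dot_fun_continuous|exact: diff_gradient].
Qed.

Lemma gradient_estimate_grad (x : X) : grad dot u x = p x.
Proof.
apply: (dot_inj dotP) => v; rewrite -[RHS]/(dot_fun (p x) v) -diffE.
have : [set g : X | forall w : X, 'd u x w = dot g w] (grad dot u x).
  by apply: getPex; exists (p x) => w; rewrite diffE.
by move=> ->.
Qed.

(** Expand [u (y + v)] at [x] and at [y], with [|v| = |x - y|], and compare the
    linear terms. *)
Lemma gradient_estimate_modulus (x y : X) :
  `|p x - p y| <= 6 * K * omega `|x - y|.
Proof.
have [->|xy] := eqVneq x y.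
  by rewrite !subrr normr0 (modulus0 omegaP) mulr0.
pose d := `|x - y|; have d0 : 0 < d by rewrite normr_gt0 subr_eq0.
have w2 : omega (d + d) <= 2 * omega d.
  by apply: le_trans (modulus_subadditive omegaP (ltW d0) (ltW d0)) _; lra.
rewrite -/d -(ler_pM2l d0).
have wd : 0 <= omega d by rewrite (modulus_ge0 omegaP)// ltW.
apply: norm_le_of_dot => [||v vd]; first exact: ltW.
  by rewrite !mulr_ge0// ltW.
have h1 := up x (y - x); have h2 := up y v; have h3 := up x (y - x + v).
rewrite [x + (y - x)]addrC subrK in h1.
rewrite [x + (y - x + v)]addrA [x + (y - x)]addrC subrK in h3.
rewrite dotDr in h3; rewrite dotBl.
rewrite (distrC y x) -/d in h1; rewrite vd in h2.
have h4 : phi `|y - x + v| <= phi (d + d).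
  apply: primitive_homo => //; apply: le_trans (ler_normD _ _) _.
  by rewrite vd (distrC y x) addrC.
have h5 : phi (d + d) <= (d + d) * omega (d + d).
  by apply: primitive_le => //; rewrite addr_ge0// ltW.
have h6 : phi d <= d * omega d by apply: primitive_le => //; rewrite ltW.
have h7 : d * omega (d + d) <= d * (2 * omega d) by rewrite ler_wpM2l// ltW.
have h8 : phi `|y - x + v| + 2 * phi d <= d * (6 * omega d) by lra.
have := ler_wpM2l K0 h8.
move: h1 h2 h3; rewrite !ler_norml => /andP[_ h1] /andP[_ h2] /andP[h3 _]; lra.
Qed.

(** The estimate at unit increments [v]. *)
Lemma gradient_estimate_bounded (B : R) (x : X) : (forall y, `|u y| <= B) ->
  `|p x| <= 2 * B + K * phi 1.
Proof.
move=> uB; have B0 : 0 <= B := le_trans (normr_ge0 _) (uB x).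
rewrite -[leLHS]mul1r; apply: norm_le_of_dot => // [|v v1].
  by rewrite addr_ge0 ?mulr_ge0// primitive_ge0.
have := up x v; rewrite v1; have := uB x; have := uB (x + v).
by rewrite !ler_norml => /andP[? ?] /andP[? ?] /andP[? ?]; lra.
Qed.

Lemma gradient_estimate_touching (K' : R) (x q : X) : 0 <= K' ->
  (forall v, `|u (x + v) - u x - dot q v| <= K' * phi `|v|) -> p x = q.
Proof.
move=> K'0 uq; apply/eqP; rewrite -subr_eq0 -normr_le0.
apply: (@le0_of_primitive _ _ omegaP (K + K') 1) => //; first exact: addr_ge0.
move=> s s0; rewrite mulr1; apply: norm_le_of_dot => [||v vs]; first exact: ltW.
  by rewrite mulr_ge0 ?addr_ge0// primitive_ge0// ltW.
have := up x v; have := uq v; rewrite vs dotBl.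
by rewrite !ler_norml => /andP[? ?] /andP[? ?]; lra.
Qed.

End Consequences.

(** The linear terms at increments of length [t] differ by at most [2 e] plus
    the second-order errors; [t] balances the two terms. *)
Lemma gradient_estimate_close (K t e : R) (u u' : X -> R) (p p' : X -> X) :
  0 <= K -> 0 < t -> gradient_estimate K u p -> gradient_estimate K u' p' ->
  (forall x, `|u x - u' x| <= e) ->
  forall x, `|p x - p' x| <= 2 * e / t + 2 * K * omega t.
Proof.
move=> K0 t0 up up' uu' x; have e0 : 0 <= e := le_trans (normr_ge0 _) (uu' x).
have wt := modulus_ge0 omegaP (ltW t0).
rewrite -(ler_pM2l t0) mulrDr mulrCA divff ?gt_eqF// mulr1.
apply: norm_le_of_dot => [||v vt]; first exact: ltW.
  by rewrite addr_ge0 ?mulr_ge0// ltW.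
have h := ler_wpM2l K0 (primitive_le omegaP (ltW t0)).
have := up x v; have := up' x v; have := uu' x; have := uu' (x + v).
rewrite vt dotBl !ler_norml => /andP[? ?] /andP[? ?] /andP[? ?] /andP[? ?]; lra.
Qed.

End Gradient.

(** * Cones *)

Section Cones.
Context {R : realType} {X : completeNormedModType R} {dot : {dot X for idfun}}.
Hypothesis dotP : hilbert_product dot.
Context {omega : R -> R}.
Hypothesis omegaP : modulus_of_continuity omega.

Local Notation phi := (phi omega).

Lemma semiconcave_of_supergradient (K : R) (u : X -> R) :
  (forall x, exists p, forall v, u (x + v) <= u x + dot p v + K * phi `|v|) ->
  semiconcave omega K u.
Proof.
move=> H x a b l /andP[l0 l1] ab0; have [p pP] := H x.
have ab : l * dot p a + (1 - l) * dot p b = 0.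
  by rewrite -!dotZr -dotDr ab0 dot0r.
have l1' : 0 <= 1 - l by rewrite subr_ge0.
have := ler_wpM2l l0 (pP a); have := ler_wpM2l l1' (pP b).
rewrite /two_point_error; lra.
Qed.

(** With [s = |x|], [r = |x + v|] and [d = |v|], convexity of [phi] gives
    [phi r - phi s <= omega r (r - s)], and [omega r] may be replaced by
    [omega s] at the cost of [d * omega d]. In a Hilbert space
    [s (r - s) - <x, v> <= d^2 / 2], which settles the case [d <= s] because
    [omega t / t] is nonincreasing; if [s < d] crude bounds suffice. When
    [x = 0] the supergradient is [0], in accordance with division by zero. *)
Lemma primitive_norm_supergradient (x v : X) :
  phi `|x + v| <= phi `|x| + dot ((omega `|x| / `|x|) *: x) v + 12 * phi `|v|.
Proof.
set s := `|x|; set d := `|v|; set r := `|x + v|.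
have [s0 d0 r0] : [/\ 0 <= s, 0 <= d & 0 <= r] by split; exact: normr_ge0.
have phid : d * omega d <= 4 * phi d by exact: primitive_ge.
rewrite dotZl; set c := dot x v.
have h1 := modulus_subgradient omegaP s0 r0.
have rs : `|r - s| <= d.
  by apply: le_trans (ler_dist_dist _ _) _; rewrite addrC addKr.
have h2 : (omega r - omega s) * (r - s) <= d * omega d.
  apply: le_trans (ler_norm _) _; rewrite normrM mulrC ler_pM//.
  apply: le_trans (modulus_lipschitz omegaP r0 s0) _.
  exact: modulus_homo.
have ws : 0 <= omega s := modulus_ge0 omegaP s0.
have wd : 0 <= omega d := modulus_ge0 omegaP d0.
have dwd : 0 <= d * omega d by rewrite mulr_ge0.
suff h3 : omega s * (r - s) - omega s / s * c <= 2 * (d * omega d) by lra.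
have [sE|sN0] := eqVneq s 0.
  by rewrite sE (modulus0 omegaP) !mul0r subr0 mulr_ge0.
have sp : 0 < s by rewrite lt_neqAle eq_sym sN0.
have := sqr_normD dotP x v; rewrite -/s -/d -/r -/c => rE.
rewrite -(ler_pM2l sp) (_ : s * _ = omega s * (s * (r - s) - c)); last first.
  by field.
have e1 : s * (r - s) - c <= d ^+ 2 / 2.
  by have := sqr_ge0 (r - s); rewrite sqrrB; lra.
have [ds|sd] := leP d s.
  apply: le_trans (ler_wpM2l ws e1) _.
  have h4 := modulus_ratio omegaP d0 ds.
  have : d * (d * omega s) <= d * (s * omega d) by rewrite ler_wpM2l.
  have : 0 <= s * (d * omega d) by rewrite mulr_ge0.
  by rewrite expr2; lra.
have cs : - c <= s * d.
  have := cauchy_schwarz dotP x v; rewrite ler_norml -/c -/s -/d.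
  by move=> /andP[? ?]; lra.
have e2 : s * (r - s) - c <= 2 * (s * d).
  have : r - s <= d by apply: le_trans rs; exact: ler_norm.
  by move=> /(ler_wpM2l s0); lra.
apply: le_trans (ler_wpM2l ws e2) _.
have h5 : omega s <= omega d by apply: modulus_homo => //; exact: ltW.
have sd0 : 0 <= s * d by rewrite mulr_ge0.
by have := ler_wpM2l sd0 h5; lra.
Qed.

Definition upper_cone (y : X) (c : R) (g : X) (x : X) : R :=
  c + dot g (x - y) + phi `|x - y|.

Definition lower_cone (y : X) (c : R) (g : X) (x : X) : R :=
  c + dot g (x - y) - phi `|x - y|.

Lemma upper_cone_semiconcave (y : X) (c : R) (g : X) :
  semiconcave omega 12 (upper_cone y c g).
Proof.
apply: semiconcave_of_supergradient => x.
exists (g + (omega `|x - y| / `|x - y|) *: (x - y)) => v.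
have := primitive_norm_supergradient (x - y) v.
rewrite /upper_cone (addrAC x v) dotDr dotDl; lra.
Qed.

Lemma lower_cone_semiconvex (y : X) (c : R) (g : X) :
  semiconvex omega 12 (lower_cone y c g).
Proof.
apply/semiconcaveN.
have -> : (fun x => - lower_cone y c g x) = upper_cone y (- c) (- g).
  apply/funext => x; rewrite /upper_cone /lower_cone.
  by rewrite dotNl opprB opprD addrC.
exact: upper_cone_semiconcave.
Qed.

End Cones.

Arguments upper_cone {R X} dot omega y c g x.
Arguments lower_cone {R X} dot omega y c g x.

(** * Extending normalized jets *)

Section NormalizedJets.
Context {R : realType} {X : completeNormedModType R} (dot : {dot X for idfun}).
Hypothesis dotP : hilbert_product dot.
Context (omega : R -> R).
Hypothesis omegaP : modulus_of_continuity omega.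
Variable E : set X.

Local Notation phi := (phi omega).

Definition taylor (fG : jet E) (y : E) (x : X) : R :=
  fG.1 y + dot (fG.2 y) (x - set_val y).

Definition whitney_bound (M : R) (fG : jet E) : Prop := forall x y z,
  `|taylor fG y x - taylor fG z x| <=
  M * (phi `|x - set_val y| + phi `|x - set_val z|).

Definition normalized_jet (fG : jet E) : Prop :=
  [/\ forall y, `|fG.1 y| <= 1, forall y, `|fG.2 y| <= 1
    & whitney_bound 1 fG].

Variables (r : R) (r0 : 0 < r) (rP : 8 <= omega r).

(** The constant barrier truncates the extension; [omega r >= 8] makes [phi t]
    at least [2 t] for [t >= r], which keeps the lower cones below it. *)
Definition barriers (fG : jet E) : set (X -> R) :=
  [set (fun=> 1 + r)] `|`
  range (fun y : E => upper_cone dot omega (set_val y) (fG.1 y) (fG.2 y)).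

Definition normalized_extension (fG : jet E) : X -> R :=
  semiconvex_envelope omega 12 (barriers fG).

Let primitive_far (t : R) : r <= t -> 2 * t <= phi t.
Proof.
move=> rt; have t0 : 0 <= t := le_trans (ltW r0) rt.
have := primitive_ge omegaP t0.
have := le_trans rP (modulus_homo omegaP (ltW r0) rt).
by move=> /(ler_wpM2l t0); lra.
Qed.

Let primitive_drop (t : R) : 0 <= t -> t - phi t <= r.
Proof.
move=> t0; have [rt|/ltW tr] := leP r t.
  by have := primitive_far rt; have := r0; lra.
by have := primitive_ge0 omegaP t0; have := r0; lra.
Qed.

Section OneJet.
Variables (fG : jet E) (fGP : normalized_jet fG).

Local Notation upper y :=
  (upper_cone dot omega (set_val y) (fG.1 y) (fG.2 y)).
Local Notation lower y :=
  (lower_cone dot omega (set_val y) (fG.1 y) (fG.2 y)).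
Local Notation F := (normalized_extension fG).

Let taylor_bound (y : E) (x : X) : `|taylor fG y x| <= 1 + `|x - set_val y|.
Proof.
have [f1 G1 _] := fGP; apply: le_trans (ler_normD _ _) _; rewrite lerD//.
apply: le_trans (cauchy_schwarz dotP _ _) _.
by rewrite -[leRHS]mul1r ler_wpM2r.
Qed.

Lemma upper_cone_far (y : E) (x : X) :
  `|x - set_val y| - 1 <= upper y x \/ `|x - set_val y| < r.
Proof.
have [rx|] := leP r `|x - set_val y|; last by right.
left; have := primitive_far rx; have := taylor_bound y x.
rewrite ler_norml /taylor /upper_cone => /andP[? ?] ?; lra.
Qed.

Let upper_ge (y : E) (x : X) : - (1 + r) <= upper y x.
Proof.
have := taylor_bound y x; have := primitive_drop (normr_ge0 (x - set_val y)).
rewrite ler_norml /taylor /upper_cone => ? /andP[? ?]; lra.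
Qed.

Let lower_le (y : E) (x : X) : lower y x <= 1 + r.
Proof.
have := taylor_bound y x; have := primitive_drop (normr_ge0 (x - set_val y)).
rewrite ler_norml /taylor /lower_cone => ? /andP[? ?]; lra.
Qed.

Let barriers0 : barriers fG !=set0.
Proof. by exists (fun=> 1 + r); left. Qed.

Let minorant_cst :
  semiconvex_minorants omega 12 (barriers fG) (fun=> - (1 + r)).
Proof.
split; first exact: semiconvex_cst.
move=> _ [->|[y _ <-]] x; last exact: upper_ge.
by have := r0; lra.
Qed.

Let minorant_lower (y : E) :
  semiconvex_minorants omega 12 (barriers fG) (lower y).
Proof.
split; first exact: lower_cone_semiconvex.
move=> _ [->|[z _ <-]] x; first exact: lower_le.
have [_ _ /(_ x y z)] := fGP.
rewrite mul1r /taylor ler_norml /lower_cone /upper_cone => /andP[? ?]; lra.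
Qed.

Let minorants0 : semiconvex_minorants omega 12 (barriers fG) !=set0.
Proof. by exists (fun=> - (1 + r)). Qed.

Lemma normalized_extension_semiconvex : semiconvex omega 12 F.
Proof. exact: envelope_semiconvex. Qed.

Lemma normalized_extension_semiconcave : semiconcave omega 12 F.
Proof.
apply: envelope_semiconcave => // _ [->|[y _ <-]].
  by apply/semiconvexN; exact: semiconvex_cst.
exact: upper_cone_semiconcave.
Qed.

Lemma normalized_extension_bounded (x : X) : `|F x| <= 1 + r.
Proof.
rewrite ler_norml; apply/andP; split.
  exact: (envelope_ge barriers0 minorants0 x minorant_cst).
have cstB : barriers fG (fun=> 1 + r) by left.
exact: (envelope_le barriers0 minorants0 x cstB).
Qed.

Lemma normalized_extension_le (y : E) (x : X) : F x <= upper y x.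
Proof. by apply: envelope_le => //; right; exists y. Qed.

Lemma normalized_extension_ge (y : E) (x : X) : lower y x <= F x.
Proof. exact: (envelope_ge barriers0 minorants0 x (minorant_lower y)). Qed.

End OneJet.

(** Lowering the extension of one jet by [(r + 3) e] gives a competitor for the
    other. Indeed the cones with vertex [y] differ at [z] by at most
    [e (1 + |z - y|)], which is enough if [|z - y| < r + 2], and beyond that
    distance the cones are above the constant barrier [1 + r]. *)
Lemma normalized_extension_lipschitz (e : R) (fG fG' : jet E) : 0 <= e ->
  normalized_jet fG -> normalized_jet fG' ->
  (forall y, `|fG.1 y - fG'.1 y| <= e) ->
  (forall y, `|fG.2 y - fG'.2 y| <= e) ->
  forall x, `|normalized_extension fG x - normalized_extension fG' x| <=
            (r + 3) * e.
Proof.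
move=> e0.
have le (gH gH' : jet E) : normalized_jet gH -> normalized_jet gH' ->
    (forall y, `|gH.1 y - gH'.1 y| <= e) ->
    (forall y, `|gH.2 y - gH'.2 y| <= e) -> forall x,
    normalized_extension gH x - normalized_extension gH' x <= (r + 3) * e.
  move=> gHP gHP' cf cG x; rewrite lerBlDr -lerBlDl.
  have cstB : barriers gH' !=set0 by exists (fun=> 1 + r); left.
  have min : semiconvex_minorants omega 12 (barriers gH')
      (fun x => normalized_extension gH x - (r + 3) * e).
    split.
      exact/semiconvex_shift/normalized_extension_semiconvex.
    have re0 : 0 <= (r + 3) * e by rewrite mulr_ge0// addr_ge0// ltW.
    move=> _ [->|[y _ <-]] z.
      rewrite lerBlDr; apply: le_trans (ler_norm _) _.
      by apply: le_trans (normalized_extension_bounded gHP z) _; rewrite lerDl.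
    have [far|near] := leP (r + 2) `|z - set_val y|.
      have [up|] := upper_cone_far gHP' y z; last by have := r0; lra.
      have := normalized_extension_bounded gHP z.
      by rewrite ler_norml => /andP[? ?]; lra.
    have := normalized_extension_le gHP y z.
    have : `|dot (gH.2 y - gH'.2 y) (z - set_val y)| <= e * (r + 2).
      apply: le_trans (cauchy_schwarz dotP _ _) _; rewrite ler_pM//.
      exact: ltW.
    have := cf y; rewrite /upper_cone dotBl !ler_norml.
    by move=> /andP[? ?] /andP[? ?]; lra.
  exact: (envelope_ge cstB (ex_intro _ _ min) x min).
move=> fP fP' cf cG x.
rewrite ler_norml le// andbT lerNl opprB; apply: le => // y.
  by rewrite distrC.
by rewrite distrC.
Qed.

End NormalizedJets.

(** * Suprema and uniform convergence *)

Section Suprema.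
Context {R : realType}.

Lemma nnsup_le (S : set (\bar R)) (a : \bar R) :
  (0 <= a)%E -> (forall s, S s -> (s <= a)%E) -> (nnsup S <= a)%E.
Proof. by move=> a0 Sa; apply: ge_ereal_sup => s [->|/Sa]. Qed.

Lemma nnsup_ge (S : set (\bar R)) (s : \bar R) : S s -> (s <= nnsup S)%E.
Proof. by move=> Ss; apply: ereal_sup_ubound; right. Qed.

Lemma nnsup_ge0 (S : set (\bar R)) : (0 <= nnsup S)%E.
Proof. by apply: ereal_sup_ubound; left. Qed.

Section SupNorm.
Context {T : Type} {V : normedModType R}.

Lemma supnorm_le (f : T -> V) (a : R) : 0 <= a ->
  (forall x, `|f x| <= a) -> (supnorm f <= a%:E)%E.
Proof.
by move=> a0 fa; apply: nnsup_le => [|_ [x _ <-]]; rewrite lee_fin.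
Qed.

Lemma bounded_funP (f : T -> V) :
  bounded_fun f <-> exists a, forall x, `|f x| <= a.
Proof.
split=> [[M [Mreal Mf]]|[a fa]].
  by exists (M + 1) => x; apply: Mf => //; rewrite ltrDl.
exists a; split; first exact: num_real.
by move=> b ab x _; exact: le_trans (fa x) (ltW ab).
Qed.

Lemma supnorm_fin (f : T -> V) : bounded_fun f -> supnorm f \is a fin_num.
Proof.
move=> /bounded_funP[a fa]; rewrite ge0_fin_numE; last exact: nnsup_ge0.
apply: (@le_lt_trans _ _ (Num.max a 0)%:E); last exact: ltry.
by apply: supnorm_le => [|x]; rewrite le_max ?lexx ?orbT// fa.
Qed.

Lemma supnorm_ub (f : T -> V) (x : T) :
  bounded_fun f -> `|f x| <= fine (supnorm f).
Proof.
move=> fb; rewrite -lee_fin fineK; last exact: supnorm_fin.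
by apply: nnsup_ge; exists x.
Qed.

Lemma supnorm_ge0 (f : T -> V) : 0 <= fine (supnorm f).
Proof. by apply: fine_ge0; exact: nnsup_ge0. Qed.

Lemma supnorm_lipschitz (f g : T -> V) (e : R) : 0 <= e ->
  bounded_fun f -> bounded_fun g -> (forall x, `|f x - g x| <= e) ->
  `|fine (supnorm f) - fine (supnorm g)| <= e.
Proof.
move=> e0.
have le (h k : T -> V) : bounded_fun h -> bounded_fun k ->
    (forall x, `|h x - k x| <= e) -> fine (supnorm h) <= fine (supnorm k) + e.
  move=> hb kb hk; rewrite -lee_fin fineK; last exact: supnorm_fin.
  apply: supnorm_le => [|x]; first by rewrite addr_ge0// supnorm_ge0.
  rewrite -(subrK (k x) (h x)) addrC; apply: le_trans (ler_normD _ _) _.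
  by rewrite lerD// supnorm_ub.
move=> fb gb fg; have h1 := le _ _ fb gb fg.
have h2 : fine (supnorm g) <= fine (supnorm f) + e.
  by apply: le => // x; rewrite distrC.
by rewrite ler_norml; apply/andP; split; lra.
Qed.

End SupNorm.

Lemma uniform_cvgP {T : choiceType} {V : normedModType R}
    (f_ : nat -> T -> V) (f : T -> V) :
  {uniform, f_ @ \oo --> f} <->
  forall e, 0 < e -> \forall n \near \oo, forall x, `|f x - f_ n x| <= e.
Proof.
split=> [fcvg e e0|H P].
  have : nbhs (f : {uniform T -> V}) [set h | forall x, `|f x - h x| <= e].
    apply/uniform_nbhs; exists [set xy | ball xy.1 e xy.2]; split.
      by rewrite -entourage_from_ballE; exists e.
    by move=> h hf x /=; have := hf x I; rewrite /= -ball_normE => /ltW.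
  by move=> /fcvg.
move=> /uniform_nbhs[U []]; rewrite -entourage_from_ballE => -[e /= e0 eU] UP.
have := H (e / 2); rewrite divr_gt0// => /(_ erefl); apply: filterS => n Hn.
apply: UP => x _; apply: eU; rewrite /= -ball_normE /ball_ /=.
by apply: le_lt_trans (Hn x) _; rewrite ltr_pdivrMr// ltr_pMr// ltr1n.
Qed.

End Suprema.

(** * The extension operator *)

Section ExtensionOperator.
Context {R : realType} {X : completeNormedModType R} (dot : {dot X for idfun}).
Hypothesis dotP : hilbert_product dot.
Context (omega : R -> R).
Hypothesis omegaP : modulus_of_continuity omega.
Context {E : set X} (A : R).
Hypothesis A0 : 0 < A.
Variables (r : R) (r0 : 0 < r) (rP : 8 <= omega r).

Local Notation phi := (phi omega).

(** Dividing by this scale brings [f], [G] and the Whitney constant below [1] at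
    once. Including the sup norms, rather than dividing by [A] only, is what
    makes the final bound linear in them. *)
Definition jet_scale (fG : jet E) : R :=
  A + (fine (supnorm fG.1) + fine (supnorm fG.2)).

Definition normalize_jet (fG : jet E) : jet E :=
  (fun y => (jet_scale fG)^-1 * fG.1 y, fun y => (jet_scale fG)^-1 *: fG.2 y).

Definition jet_extension (fG : jet E) : X -> R^o := fun x =>
  jet_scale fG * normalized_extension dot omega r (normalize_jet fG) x.

Definition extendable_jets : set (jet E) :=
  J1omega_b dot omega E `&` [set fG | (jetA dot omega fG <= A%:E)%E].

Local Notation D := extendable_jets.
Local Notation M := jet_scale.

Lemma jet_scale_ge (fG : jet E) : A <= M fG.
Proof. by rewrite lerDl addr_ge0// supnorm_ge0. Qed.

Lemma jet_scale_gt0 (fG : jet E) : 0 < M fG.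
Proof. exact: lt_le_trans (jet_scale_ge fG). Qed.

(** [jetA] ignores the configurations [x = y = z], where its quotient would be
    [0 / 0]; the inequality is trivial there. *)
Lemma extendable_whitney_bound (fG : jet E) :
  D fG -> whitney_bound dot omega A fG.
Proof.
move=> [_ /= leA] x y z.
have [/andP[]|] := boolP ((`|x - set_val y| == 0) && (`|x - set_val z| == 0)).
  rewrite !normr_eq0 !subr_eq0 => /eqP xy /eqP xz.
  have -> : y = z by apply: val_inj; rewrite -[LHS]xy -[RHS]xz.
  by rewrite subrr normr0 mulr_ge0 ?(ltW A0)// addr_ge0// primitive_ge0.
rewrite negb_and => xyz.
have phi_gt0 : 0 < phi `|x - set_val y| + phi `|x - set_val z|.
  case/orP: xyz => xyz.
    rewrite ltr_pwDl ?primitive_ge0// primitive_gt0//.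
    by rewrite lt_neqAle eq_sym xyz /=.
  rewrite ltr_wpDl ?primitive_ge0// primitive_gt0//.
  by rewrite lt_neqAle eq_sym xyz /=.
rewrite -ler_pdivrMr// -lee_fin; apply: le_trans leA.
apply: nnsup_ge; exists x, y, z; split => //.
rewrite lt_neqAle addr_ge0// andbT eq_sym paddr_eq0// negb_and.
exact: xyz.
Qed.

Lemma normalize_jet_normalized (fG : jet E) :
  D fG -> normalized_jet dot omega (normalize_jet fG).
Proof.
move=> fGD; have [[_ fb Gb] _] := fGD.
have M0 := jet_scale_gt0 fG; have MA := jet_scale_ge fG.
have fM := supnorm_ge0 fG.1; have GM := supnorm_ge0 fG.2.
split => [y|y|x y z] /=.
- rewrite normrM normfV (gtr0_norm M0) mulrC ler_pdivrMr// mul1r.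
  by apply: le_trans (supnorm_ub y fb) _; rewrite /M; have := A0; lra.
- rewrite normrZ normfV (gtr0_norm M0) mulrC ler_pdivrMr// mul1r.
  by apply: le_trans (supnorm_ub y Gb) _; rewrite /M; have := A0; lra.
- rewrite /taylor /= !dotZl -!mulrDr -mulrBr normrM normfV (gtr0_norm M0).
  rewrite mulrC ler_pdivrMr// mul1r mulrC.
  apply: le_trans (extendable_whitney_bound fGD x y z) _.
  by rewrite ler_wpM2r// addr_ge0// primitive_ge0.
Qed.

Lemma jet_extension_bounded (fG : jet E) (x : X) : D fG ->
  `|jet_extension fG x| <= M fG * (1 + r).
Proof.
move=> /normalize_jet_normalized fGP.
rewrite normrM (gtr0_norm (jet_scale_gt0 fG)) ler_wpM2l//.
  exact: ltW (jet_scale_gt0 fG).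
exact: (normalized_extension_bounded dotP omegaP r0 rP fGP).
Qed.

Lemma jet_extension_gradient (fG : jet E) : D fG ->
  gradient_estimate (dot := dot) (omega := omega) (12 * M fG)
    (jet_extension fG) (grad dot (jet_extension fG)).
Proof.
move=> /normalize_jet_normalized fGP; have M0 := jet_scale_gt0 fG.
have [p pP] := ex_gradient_estimate dotP omegaP (ler0n R 12)
  (normalized_extension_semiconvex dotP omegaP r0 rP fGP)
  (normalized_extension_semiconcave dotP omegaP r0 rP fGP)
  (normalized_extension_bounded dotP omegaP r0 rP fGP).
have qP : gradient_estimate (dot := dot) (omega := omega) (12 * M fG)
    (jet_extension fG) (fun x => M fG *: p x).
  move=> x v; rewrite /jet_extension dotZl -!mulrBr normrM (gtr0_norm M0).
  by rewrite mulrAC mulrC ler_wpM2r// ltW.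
have M120 : 0 <= 12 * M fG by rewrite mulr_ge0// ltW.
by move=> x v; rewrite (gradient_estimate_grad dotP omegaP M120 qP); exact: qP.
Qed.

(** At the vertex the two cones have the same first-order expansion, so this
    also determines the gradient there. *)
Lemma jet_extension_touching (fG : jet E) (y : E) (x : X) : D fG ->
  `|jet_extension fG x - taylor dot fG y x| <= M fG * phi `|x - set_val y|.
Proof.
move=> /normalize_jet_normalized fGP; have M0 := jet_scale_gt0 fG.
have up := normalized_extension_le dotP omegaP r0 rP fGP y x.
have low := normalized_extension_ge dotP omegaP r0 rP fGP y x.
have -> : taylor dot fG y x = M fG * taylor dot (normalize_jet fG) y x.
  by rewrite /taylor /= dotZl -mulrDr mulrA divff ?mul1r// gt_eqF.
rewrite /jet_extension -mulrBr normrM (gtr0_norm M0) (ler_wpM2l (ltW M0))//.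
move: up low; rewrite /upper_cone /lower_cone ler_norml /taylor => up low.
by apply/andP; split; lra.
Qed.

Lemma jet_extension_interpolates (fG : jet E) (y : E) : D fG ->
  jet_extension fG (set_val y) = fG.1 y /\
  grad dot (jet_extension fG) (set_val y) = fG.2 y.
Proof.
move=> fGD; have touch x := jet_extension_touching y x fGD.
have fy : jet_extension fG (set_val y) = fG.1 y.
  apply/eqP; rewrite -subr_eq0 -normr_le0.
  have := touch (set_val y).
  by rewrite subrr normr0 modulus_primitive0 mulr0 /taylor subrr dot0r addr0.
split=> //.
have M0 := jet_scale_gt0 fG.
apply: (gradient_estimate_touching dotP omegaP _
  (jet_extension_gradient fGD) (K' := M fG)).
- by rewrite mulr_ge0// ltW.
- exact: ltW.
- move=> v; have := touch (set_val y + v); rewrite /taylor addrAC subrr add0r.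
  by rewrite fy opprD addrA.
Qed.

(** The sup norm contributes [1 + r], the gradient [2 (1 + r) + 12 phi 1] and
    its modulus [6 * 12]. *)
Definition operator_constant : R := 3 * (1 + r) + 12 * phi 1 + 72.

Lemma jet_extension_norm (fG : jet E) : D fG ->
  (C1omega_b_norm dot omega (jet_extension fG) <=
   (operator_constant * M fG)%:E)%E.
Proof.
move=> fGD; have gradP := jet_extension_gradient fGD.
have M0 := jet_scale_gt0 fG.
have ub x := jet_extension_bounded x fGD.
have K0 : 0 <= 12 * M fG by rewrite mulr_ge0// ltW.
have rM : 0 <= M fG * (1 + r) := le_trans (normr_ge0 _) (ub 0).
have phi1 : 0 <= phi 1 by exact: primitive_ge0.
rewrite (_ : _ * _ = M fG * (1 + r) + (2 * (M fG * (1 + r)) + 12 * M fG * phi 1)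
  + 6 * (12 * M fG)); last by rewrite /operator_constant; ring.
rewrite !EFinD; apply: leeD; first apply: leeD.
- exact: supnorm_le.
- apply: supnorm_le => [|x]; first by apply: addr_ge0; exact: mulr_ge0.
  exact: (gradient_estimate_bounded dotP omegaP K0 gradP).
- apply: nnsup_le => [|_ [[x y] /= xy <-]]; first by rewrite lee_fin mulr_ge0.
  rewrite lee_fin ler_pdivrMr; last first.
    by rewrite (modulus_gt0 omegaP)// normr_gt0 subr_eq0.
  exact: (gradient_estimate_modulus dotP omegaP K0 gradP).
Qed.

Lemma jet_extension_C1omega_b (fG : jet E) : D fG ->
  C1omega_b dot omega (jet_extension fG).
Proof.
move=> fGD; have gradP := jet_extension_gradient fGD.
have M0 := jet_scale_gt0 fG.
have ub x := jet_extension_bounded x fGD.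
have K0 : 0 <= 12 * M fG by rewrite mulr_ge0// ltW.
split.
- split=> [x|].
    exact: (gradient_estimate_differentiable dotP omegaP K0 gradP).
  apply: le_lt_trans (ltry (operator_constant * M fG)).
  apply: le_trans (jet_extension_norm fGD); rewrite /C1omega_b_norm leeDr//.
  by rewrite adde_ge0// nnsup_ge0.
- by apply/bounded_funP; exists (M fG * (1 + r)).
- apply/bounded_funP; eexists => x.
  exact: (gradient_estimate_bounded dotP omegaP K0 gradP x ub).
Qed.

Lemma jet_scale_close (e : R) (fG fG' : jet E) : 0 <= e -> D fG -> D fG' ->
  (forall y, `|fG.1 y - fG'.1 y| <= e) ->
  (forall y, `|fG.2 y - fG'.2 y| <= e) ->
  `|M fG - M fG'| <= 2 * e.
Proof.
move=> e0 [[_ fb Gb] _] [[_ fb' Gb'] _] cf cG.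
have := supnorm_lipschitz e0 fb fb' cf; have := supnorm_lipschitz e0 Gb Gb' cG.
by rewrite /M !ler_norml => /andP[? ?] /andP[? ?]; apply/andP; split; lra.
Qed.

(** The bound [|v| <= a] absorbs the change of scale, so the estimate does not
    depend on the size of the jet. *)
Let normalize_close {V : normedModType R} (a b e : R) (v w : V) :
  A <= a -> A <= b -> `|v| <= a -> `|v - w| <= e -> `|a - b| <= 2 * e ->
  `|a^-1 *: v - b^-1 *: w| <= 3 / A * e.
Proof.
move=> Aa Ab va vw ab; have a0 : 0 < a := lt_le_trans A0 Aa.
have b0 : 0 < b := lt_le_trans A0 Ab.
have e0 : 0 <= e := le_trans (normr_ge0 _) vw.
have -> : a^-1 *: v - b^-1 *: w = b^-1 *: ((v - w) - ((a - b) / a) *: v).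
  rewrite !scalerBr scalerA.
  have -> : b^-1 * ((a - b) / a) = b^-1 - a^-1 by field; rewrite !gt_eqF.
  by rewrite scalerBl opprB [RHS]addrC addrA subrK.
rewrite normrZ gtr0_norm ?invr_gt0//.
have h : `|v - w - (a - b) / a *: v| <= 3 * e.
  apply: le_trans (ler_normB _ _) _.
  have : `|(a - b) / a *: v| <= 2 * e.
    rewrite normrZ normrM normfV (gtr0_norm a0) -mulrA -[leRHS]mulr1 ler_pM//.
      by rewrite mulr_ge0// invr_ge0 ltW.
    by rewrite mulrC ler_pdivrMr// mul1r.
  lra.
rewrite [leRHS](_ : _ = A^-1 * (3 * e)); last by ring.
apply: ler_pM => //; first by rewrite invr_ge0 ltW.
by rewrite lef_pV2.
Qed.

(** A local Lipschitz constant, for perturbations of size at most [1]. *)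
Definition operator_lipschitz (fG : jet E) : R :=
  (M fG + 2) * ((r + 3) * (3 / A)) + 2 * (1 + r).

Lemma jet_extension_close (e : R) (fG fG' : jet E) : 0 <= e -> e <= 1 ->
  D fG -> D fG' ->
  (forall y, `|fG.1 y - fG'.1 y| <= e) ->
  (forall y, `|fG.2 y - fG'.2 y| <= e) ->
  forall x, `|jet_extension fG x - jet_extension fG' x| <=
            operator_lipschitz fG * e.
Proof.
move=> e0 e1 fGD fGD' cf cG x.
have MM := jet_scale_close e0 fGD fGD' cf cG.
have M0 := jet_scale_gt0 fG; have M0' := jet_scale_gt0 fG'.
have fGP := normalize_jet_normalized fGD.
have fGP' := normalize_jet_normalized fGD'.
have [[_ fb Gb] _] := fGD.
have fM y : `|fG.1 y| <= M fG.
  apply: le_trans (supnorm_ub y fb) _; rewrite /M.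
  by have := supnorm_ge0 fG.2; have := A0; lra.
have GM y : `|fG.2 y| <= M fG.
  apply: le_trans (supnorm_ub y Gb) _; rewrite /M.
  by have := supnorm_ge0 fG.1; have := A0; lra.
have close : `|normalized_extension dot omega r (normalize_jet fG) x -
    normalized_extension dot omega r (normalize_jet fG') x| <=
    (r + 3) * (3 / A * e).
  apply: (normalized_extension_lipschitz dotP omegaP r0 rP) => // [|y|y].
  - by rewrite mulr_ge0// divr_ge0// ltW.
  - exact: (normalize_close (jet_scale_ge fG) (jet_scale_ge fG')
      (fM y) (cf y) MM).
  - exact: (normalize_close (jet_scale_ge fG) (jet_scale_ge fG')
      (GM y) (cG y) MM).
have bd := normalized_extension_bounded dotP omegaP r0 rP fGP x.
rewrite /jet_extension; move: bd close.
set a := normalized_extension _ _ _ _ _.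
set b := normalized_extension _ _ _ _ _.
move=> bd close.
have -> : M fG * a - M fG' * b = M fG' * (a - b) + (M fG - M fG') * a by ring.
apply: le_trans (ler_normD _ _) _; rewrite !normrM (gtr0_norm M0').
have M2 : M fG' <= M fG + 2 by move: MM; rewrite ler_norml => /andP[? ?]; lra.
have h1 : M fG' * `|a - b| <= (M fG + 2) * ((r + 3) * (3 / A * e)).
  by rewrite ler_pM// ltW.
have h2 : `|M fG - M fG'| * `|a| <= 2 * e * (1 + r) by rewrite ler_pM.
by rewrite /operator_lipschitz; lra.
Qed.

Lemma jet_extension_continuous (fGn : nat -> jet E) (fG : jet E) :
  (forall n, D (fGn n)) -> D fG ->
  {uniform, (fun n => (fGn n).1) @ \oo --> fG.1} ->
  {uniform, (fun n => (fGn n).2) @ \oo --> fG.2} ->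
  {uniform, (fun n => jet_extension (fGn n)) @ \oo --> jet_extension fG} /\
  {uniform, (fun n => grad dot (jet_extension (fGn n))) @ \oo
            --> grad dot (jet_extension fG)}.
Proof.
move=> fGnD fGD /uniform_cvgP fcvg /uniform_cvgP Gcvg.
have L0 : 0 < operator_lipschitz fG.
  rewrite ltr_wpDl//; last by rewrite mulr_gt0// addr_gt0.
  have M0 := ltW (jet_scale_gt0 fG); have A0' := ltW A0; have r0' := ltW r0.
  apply: mulr_ge0; first exact: addr_ge0.
  by apply: mulr_ge0; [exact: addr_ge0|exact: divr_ge0].
have close e : 0 < e -> \forall n \near \oo, M (fGn n) <= M fG + 2 /\
    forall x, `|jet_extension fG x - jet_extension (fGn n) x| <= e.
  move=> e0; pose d := Num.min 1 (e / operator_lipschitz fG).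
  have d0 : 0 < d by rewrite lt_min ltr01 divr_gt0.
  have d1 : d <= 1 by rewrite ge_min lexx.
  have de : operator_lipschitz fG * d <= e.
    by rewrite mulrC -ler_pdivlMr// ge_min lexx orbT.
  apply: filterS2 (fcvg _ d0) (Gcvg _ d0) => n cf cG; split=> [|x].
    have := jet_scale_close (ltW d0) fGD (fGnD n) cf cG.
    by rewrite ler_norml => /andP[? ?]; lra.
  apply: le_trans de.
  exact: (jet_extension_close (ltW d0) d1 fGD (fGnD n) cf cG).
split; apply/uniform_cvgP => e e0.
  by apply: filterS (close _ e0) => n [].
pose K := 12 * (M fG + 2).
have K0 : 0 < K by rewrite mulr_gt0// addr_gt0// jet_scale_gt0.
have K20 : 0 < 2 * K by exact: mulr_gt0.
have [t t0 tP] : exists2 t, 0 < t & omega t < e / 2 / (2 * K).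
  by apply: modulus_small => //; rewrite !divr_gt0.
rewrite ltr_pdivlMr// in tP.
have et : 0 < e * t / 4 by rewrite divr_gt0// mulr_gt0.
apply: filterS (close _ et) => n [Mn un] x.
have weaken (gH : jet E) : M gH <= M fG + 2 -> D gH ->
    gradient_estimate (dot := dot) (omega := omega) K
      (jet_extension gH) (grad dot (jet_extension gH)).
  move=> MH gHD y v; apply: le_trans (jet_extension_gradient gHD y v) _.
  by rewrite ler_wpM2r ?primitive_ge0// /K ler_pM2l.
have wG : M fG <= M fG + 2 by rewrite lerDl.
apply: le_trans (gradient_estimate_close dotP omegaP (ltW K0) t0
  (weaken _ wG fGD) (weaken _ Mn (fGnD n)) un x) _.
have -> : 2 * (e * t / 4) / t = e / 2 by field; rewrite gt_eqF.
by lra.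
Qed.

End ExtensionOperator.

Theorem theorem4p2 (R : realType) (omega : R -> R)
    (omegaP : modulus_of_continuity omega) :
  exists C : R, 0 < C /\
  forall (X : completeNormedModType R) (dot : {dot X for idfun})
         (dotP : hilbert_product dot) (E : set X) (E0 : E !=set0)
         (A : R) (A0 : 0 < A),
  let D : set (jet E) :=
    J1omega_b dot omega E `&` [set fG | (jetA dot omega fG <= A%:E)%E] in
  exists Ext : jet E -> (X -> R^o),
  [/\ set_fun D (C1omega_b dot omega) Ext,
      forall fG : jet E, D fG -> forall y : E,
        Ext fG (set_val y) = fG.1 y /\ grad dot (Ext fG) (set_val y) = fG.2 y,
      forall fG : jet E, D fG ->
        (C1omega_b_norm dot omega (Ext fG)
           <= C%:E * (supnorm fG.1 + supnorm fG.2 + A%:E))%E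
    & forall (fGn : nat -> jet E) (fG : jet E),
        (forall n, D (fGn n)) -> D fG ->
        {uniform, (fun n => (fGn n).1) @ \oo --> fG.1} ->
        {uniform, (fun n => (fGn n).2) @ \oo --> fG.2} ->
        {uniform, (fun n => Ext (fGn n)) @ \oo --> Ext fG} /\
        {uniform, (fun n => grad dot (Ext (fGn n))) @ \oo
                  --> grad dot (Ext fG)}].
Proof.
have [r r0 rP] := modulus_large omegaP 8.
exists (operator_constant omega r); split.
  apply: ltr_wpDl => //; apply: addr_ge0.
    by rewrite mulr_ge0// addr_ge0// ltW.
  by rewrite mulr_ge0// primitive_ge0.
move=> X dot dotP E _ A A0 D; exists (jet_extension dot omega A r); split.
- by move=> fG fGD; exact: jet_extension_C1omega_b.
- move=> fG fGD y; exact: jet_extension_interpolates.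
- move=> fG fGD; have [[_ fb Gb] _] := fGD.
  apply: le_trans (jet_extension_norm dotP omegaP A0 r0 rP fGD) _.
  rewrite EFinM /jet_scale addrC; move: (operator_constant _ _) => C.
  by rewrite !EFinD !fineK ?supnorm_fin.
- by move=> fGn fG; exact: jet_extension_continuous.
Qed.
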